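(* Let $m\ge2$ and $n\ge1$ be integers and let $\mathcal{C}$ be a symmetric Cauchy tensor of order $m$ and dimension $n$. Then $\mathcal{C}$ is centrosymmetric if and only if $\mathcal{C}J=\mathcal{C}$.
   Context: Write $[n]=\{1,\dots,n\}$. Given $c=(c_1,\dots,c_n)\in\mathbb{R}^n$ with $c_{i_1}+\cdots+c_{i_m}\ne0$ for all $i_1,\dots,i_m\in[n]$, the (symmetric) Cauchy tensor of order $m$ and dimension $n$ with generating vector $c$ is the real tensor $\mathcal{C}=(c_{i_1\cdots i_m})$ with entries $c_{i_1i_2\cdots i_m}=\dfrac{1}{c_{i_1}+c_{i_2}+\cdots+c_{i_m}}$. A tensor $(a_{i_1\cdots i_m})$ of order $m$ and dimension $n$ is centrosymmetric if $a_{i_1\cdots i_m}=a_{n-i_1+1,\dots,n-i_m+1}$ for all indices in $[n]$. $J$ is the $n\times n$ matrix with $J_{ij}=\delta_{i,\,n-j+1}$, and $\mathcal{C}J$ is the tensor of order $m$ and dimension $n$ with entries $(\mathcal{C}J)_{i_1\cdots i_m}=\sum_{j_2,\dots,j_m\in[n]}c_{i_1j_2\cdots j_m}J_{j_2i_2}\cdots J_{j_mi_m}$. *)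

(* Defs.v *)
From HB Require Import structures.
From mathcomp Require Import all_boot all_order all_algebra.
From mathcomp Require Import reals.

Set Implicit Arguments.
Unset Strict Implicit.
Unset Printing Implicit Defensive.

Import Order.TTheory GRing.Theory Num.Theory.

Local Open Scope ring_scope.

(* Indices are 0-based: position 0 in 'I_m is the paper's first index, and
   rev_ord : 'I_n -> 'I_n is i |-> n - i + 1 on [n]. *)
Definition multi_index (m n : nat) := {ffun 'I_m -> 'I_n}.

Definition tensor (R : Type) (m n : nat) := {ffun multi_index m n -> R}.

Definition cauchy_generating (R : realType) (m n : nat) (c : 'rV[R]_n) : Prop :=
  forall i : multi_index m n, \sum_(k < m) c 0 (i k) != 0.

Definition cauchy_tensor (R : realType) (m n : nat) (c : 'rV[R]_n) :
    tensor R m n :=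
  [ffun i : multi_index m n => (\sum_(k < m) c 0 (i k))^-1].

Definition is_cauchy_tensor (R : realType) (m n : nat) (C : tensor R m n) : Prop :=
  exists2 c : 'rV[R]_n, cauchy_generating m c & C = cauchy_tensor m c.

Definition centrosymmetric (R : Type) (m n : nat) (A : tensor R m n) : Prop :=
  forall i : multi_index m n, A i = A [ffun k => rev_ord (i k)].

Definition exchange_mx (R : realType) (n : nat) : 'M[R]_n :=
  \matrix_(i, j) (i == rev_ord j)%:R.

(* The sum over j_2, ..., j_m is a sum over full multi-indices j whose entry at
   position 0 is that of i; this avoids assuming m > 0 in the definition. *)
Definition tensor_mulmx (R : realType) (m n : nat)
    (A : tensor R m n) (M : 'M[R]_n) : tensor R m n :=
  [ffun i : multi_index m n =>
    \sum_(j : multi_index m n |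
            [forall k : 'I_m, (k == 0%N :> nat) ==> (j k == i k)])
      A j * \prod_(k < m | k != 0%N :> nat) M (j k) (i k)].

(* Main.v *)
Require Import Defs.
From HB Require Import structures.
From mathcomp Require Import all_boot all_order all_algebra.
From mathcomp Require Import reals.

(** Reversing the indices of a Cauchy tensor at any fixed nonempty set of
    positions leaves the tensor unchanged exactly when the generating vector is
    palindromic: evaluate at a constant multi-index and cancel the number of
    reversed positions. Centrosymmetry is the case of all positions, and
    [C J = C] the case of all positions but the first. *)

Import GRing.Theory Num.Theory.
Local Open Scope ring_scope.

Definition rev_on {m n : nat} (P : pred 'I_m) (i : multi_index m n) :
    multi_index m n :=
  [ffun k => if P k then rev_ord (i k) else i k].

Lemma cauchy_tensor_rev_on (R : realType) (m n : nat) (c : 'rV[R]_n)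
    (P : pred 'I_m) (k0 : 'I_m) :
  P k0 ->
  (forall i, cauchy_tensor m c i = cauchy_tensor m c (rev_on P i)) <->
  (forall p, c 0 (rev_ord p) = c 0 p).
Proof.
move=> Pk0; split=> [inv p | pal i]; last first.
  rewrite !ffunE; congr (_^-1); apply: eq_bigr => k _.
  by rewrite ffunE; case: ifP => // _; rewrite pal.
(* Inversion is injective on the whole field, with [0^-1 = 0], so the two denominators agree. *)
have := inv [ffun=> p]; rewrite !ffunE => /invr_inj.
rewrite (bigID P) [in RHS](bigID P) /=.
rewrite [X in _ + X = _ -> _](eq_bigr (fun=> c 0 p)); last first.
  by move=> k _; rewrite ffunE.
rewrite [X in _ = _ + X -> _](eq_bigr (fun=> c 0 p)); last first.
  by move=> k /negbTE nPk; rewrite !ffunE nPk.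
move/addIr.
rewrite (eq_bigr (fun=> c 0 p)); last by move=> k _; rewrite ffunE.
rewrite [in RHS](eq_bigr (fun=> c 0 (rev_ord p))); last first.
  by move=> k Pk; rewrite !ffunE Pk.
(* The multiple [#|P|] cancels: it is positive because [k0] satisfies [P]. *)
rewrite !sumr_const => eqc; apply: (@pmulrnI _ #|P|) => //.
by apply/card_gt0P; exists k0.
Qed.

(** Each column of the exchange matrix has a single nonzero entry, so only one term of the sum
    survives. *)
Lemma tensor_mulmx_exchange (R : realType) (m n : nat) (A : tensor R m n)
    (i : multi_index m n) :
  tensor_mulmx A (exchange_mx R n) i =
  A (rev_on (fun k => k != 0%N :> nat) i).
Proof.
rewrite ffunE (bigD1 (rev_on (fun k => k != 0%N :> nat) i)) /=; last first.
  by apply/forallP => k; apply/implyP => k0; rewrite ffunE k0.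
rewrite big1 ?mulr1 => [|k k0]; last by rewrite mxE ffunE k0 eqxx.
rewrite big1 ?addr0 // => j /andP[/forallP fix0 neq_j].
(* Since [j] agrees with [i] at position 0, the mismatch lies at a later position, where the matrix
   factor is zero. *)
have [k neq_jk] : exists k, j k != rev_on (fun k => k != 0%N :> nat) i k.
  apply/existsP; apply: contraR neq_j; rewrite negb_exists => /forallP eqj.
  by apply/eqP/ffunP => k; apply/eqP; move: (eqj k); rewrite negbK.
have k0 : k != 0%N :> nat.
  apply: contraNN neq_jk => k0.
  by have := fix0 k; rewrite ffunE k0 implyTb.
move: neq_jk; rewrite ffunE k0 => /negbTE neq_jk.
by rewrite (bigD1 k) //= mxE neq_jk mul0r mulr0.
Qed.

Theorem corollary5p1 (R : realType) (m n : nat) (hm : (2 <= m)%N) (hn : (1 <= n)%N)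
    (C : tensor R m n) (hC : is_cauchy_tensor C) :
  centrosymmetric C <-> tensor_mulmx C (exchange_mx R n) = C.
Proof.
case: hC => c _ ->.
have centroE : centrosymmetric (cauchy_tensor m c) <->
    forall p, c 0 (rev_ord p) = c 0 p.
  exact: (@cauchy_tensor_rev_on _ _ _ c predT (Ordinal hm) isT).
(* As [hm] reads [1 < m], [Ordinal hm] is position 1, a reversed position other than the first. *)
have [rev_pal pal_rev] := @cauchy_tensor_rev_on _ _ _ c
  (fun k => k != 0%N :> nat) (Ordinal hm) isT.
rewrite centroE; split=> [pal | eqC].
  by apply/ffunP => i; rewrite tensor_mulmx_exchange -pal_rev.
by apply: rev_pal => i; rewrite -tensor_mulmx_exchange eqC.
Qed.
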